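(* Let $X$ be a real Hilbert space, let $D\subseteq X$ be a nonempty weakly sequentially closed set, let $\Gamma\subseteq\mathbb{R}$ be a nonempty closed set, and let $(T_\gamma)_{\gamma\in\Gamma}$ be a family of nonexpansive operators from $D$ to $X$ such that for every $x\in D$ the map $\gamma\mapsto T_\gamma x$ is (strongly) continuous on $\Gamma$. Then the operator $$D\times\Gamma\to X\colon(x,\gamma)\mapsto(\mathrm{Id}-T_\gamma)x$$ is parametrically demiclosed.
   Context: An operator $T\colon D\to X$ is nonexpansive if $\|Tx-Ty\|\le\|x-y\|$ for all $x,y\in D$. An operator $G\colon D\times\Gamma\to X$, with $D\subseteq X$ and $\Gamma\subseteq\mathbb{R}$ nonempty, is parametrically demiclosed if its graph is sequentially closed in $(X^{\text{weak}}\times\Gamma)\times X^{\text{strong}}$, where $X^{\text{weak}}$ (resp. $X^{\text{strong}}$) denotes $X$ with its weak (resp. norm) topology; i.e., whenever $(x_n,\gamma_n)_{n\in\mathbb{N}}$ is a sequence in $D\times\Gamma$ with $x_n\rightharpoonup x$ weakly in $X$, $\gamma_n\to\gamma\in\Gamma$ and $G(x_n,\gamma_n)\to u$ in norm, one has $x\in D$ and $G(x,\gamma)=u$. *)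

(* Defs.v *)
From HB Require Import structures.
From mathcomp Require Import all_boot all_order all_algebra sesquilinear.
From mathcomp Require Import all_classical all_reals all_analysis.

Set Implicit Arguments.
Unset Strict Implicit.
Unset Printing Implicit Defensive.

Import Order.TTheory GRing.Theory Num.Theory.
Import numFieldNormedType.Exports.

Local Open Scope classical_set_scope.
Local Open Scope ring_scope.

HB.mixin Record CompleteNormedModule_isHilbert (R : realType) (X : Type)
    & CompleteNormedModule R X := {
  inner : {dot X for (@idfun R)} ;
  inner_normE : forall x : X, `|x| ^+ 2 = inner x x
}.

#[short(type="hilbertType")]
HB.structure Definition Hilbert (R : realType) :=
  {X of CompleteNormedModule_isHilbert R X & CompleteNormedModule R X}.

Definition dual (R : realType) (X : normedModType R) : Type :=
  {f : {linear X -> R^o} | continuous f}.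

(* [weak X] is [X] with the coarsest topology for which every element of the
   topological dual is continuous. *)
Definition weak (R : realType) (X : normedModType R) : Type :=
  sup_topology (fun f : dual X =>
    Topological.on (initial_topology (proj1_sig f : X -> R^o))).

HB.instance Definition _ (R : realType) (X : normedModType R) :=
  Topological.on (weak X).

Definition sequentially_closed (T : topologicalType) (A : set T) : Prop :=
  forall (u : nat -> T) (l : T), (forall n, A (u n)) -> u @ \oo --> l -> A l.

Definition weakly_sequentially_closed (R : realType) (X : normedModType R)
    (D : set X) : Prop :=
  sequentially_closed (D : set (weak X)).

Definition nonexpansive (R : realType) (X : normedModType R)
    (D : set X) (T : X -> X) : Prop :=
  forall x y, D x -> D y -> `|T x - T y| <= `|x - y|.

Section demiclosed.
Variables (R : realType) (X : normedModType R) (D : set X) (Gamma : set R).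

(* An operator on [D * Gamma] is represented by a total function, whose values
   outside of [D * Gamma] are not used. The type [set_type Gamma] carries the
   topology induced by that of [R]. *)
Definition op_graph (G : X -> R -> X) : set ((weak X * set_type Gamma) * X) :=
  [set p | D p.1.1 /\ G p.1.1 (\val p.1.2) = p.2].

Definition parametrically_demiclosed (G : X -> R -> X) : Prop :=
  sequentially_closed (op_graph G).

End demiclosed.

Lemma initial_cvgP (S : choiceType) (T : topologicalType) (f : S -> T)
    (F : set_system S) (s : S) : Filter F ->
  F --> (s : initial_topology f) <-> f @ F --> f s.
Proof.
move=> FF; split=> [Fs|fFs A].
  apply: cvg_trans (@initial_continuous S T f s).
  exact: cvg_fmap2.
rewrite /= nbhsE => -[B [[C oC <-] Cs] BA].
by apply: (filterS BA); apply: fFs; exact: open_nbhs_nbhs.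
Qed.

Lemma weak_cvgP (R : realType) (X : normedModType R) (u : nat -> X) (l : X) :
  u @ \oo --> (l : weak X) <->
  forall f : {linear X -> R^o}, continuous f -> f \o u @ \oo --> f l.
Proof.
split=> [/cvg_sup ul f cf|ul].
  by have /initial_cvgP := ul (exist _ f cf).
apply/cvg_sup => -[f cf]; apply/initial_cvgP; exact: ul.
Qed.

Lemma parametrically_demiclosedP (R : realType) (X : normedModType R)
    (D : set X) (Gamma : set R) (G : X -> R -> X) :
  parametrically_demiclosed D Gamma G <->
  forall (x_ : nat -> X) (g_ : nat -> R) (x : X) (g : R) (v : X),
    (forall n, D (x_ n)) -> (forall n, Gamma (g_ n)) -> Gamma g ->
    x_ @ \oo --> (x : weak X) -> g_ @ \oo --> g ->
    G (x_ n) (g_ n) @[n --> \oo] --> v -> D x /\ G x g = v.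
Proof.
split=> [H x_ g_ x g v Dx Gg_ Gg cx cg cG|H u [[x g] v] uG cu].
  pose gS n : set_type Gamma := exist _ (g_ n) (mem_set (Gg_ n)).
  pose gl : set_type Gamma := exist _ g (mem_set Gg).
  have cgS : gS @ \oo --> gl by exact/initial_cvgP.
  have c1 : (x_ n : weak X, gS n) @[n --> \oo] --> (x : weak X, gl).
    exact (cvg_pair cx cgS).
  have c2 : ((x_ n : weak X, gS n), G (x_ n) (g_ n)) @[n --> \oo] -->
      ((x : weak X, gl), v).
    exact (cvg_pair c1 cG).
  have gu n : op_graph D G ((x_ n : weak X, gS n), G (x_ n) (g_ n)).
    by split; [exact: Dx|].
  by have [] := H _ _ gu c2.
have cxg : (fun n => (u n).1) @ \oo --> (x : weak X, g).
  exact: (cvg_comp _ fst cu cvg_fst).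
have cv : (fun n => (u n).2) @ \oo --> v.
  exact: (cvg_comp _ snd cu cvg_snd).
have cx : (fun n => (u n).1.1) @ \oo --> (x : weak X).
  exact: (cvg_comp _ fst cxg cvg_fst).
have cg : (fun n => (u n).1.2) @ \oo --> g.
  exact: (cvg_comp _ snd cxg cvg_snd).
apply: (H (fun n => (u n).1.1) (fun n => \val (u n).1.2)) => //.
- by move=> n; have [] := uG n.
- by move=> n; exact/set_mem/(valP (u n).1.2).
- exact/set_mem/(valP g).
- by move/initial_cvgP: cg.
- apply: cvg_trans cv; apply: near_eq_cvg; apply: nearW => n.
  by have [_ /= ->] := uG n.
Qed.

(* Main.v *)
Require Import Defs.
From HB Require Import structures.
From mathcomp Require Import all_boot all_order all_algebra.
From mathcomp Require Import all_classical all_reals all_analysis.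
From mathcomp Require Import sesquilinear ring lra.

Set Implicit Arguments.
Unset Strict Implicit.
Unset Printing Implicit Defensive.

Import Order.TTheory GRing.Theory Num.Theory.
Import numFieldNormedType.Exports.

Local Open Scope classical_set_scope.
Local Open Scope ring_scope.

(** Let [x_ n] converge weakly to [x], let [g_ n] converge to [g] in [Gamma],
    and let [x_ n - T (g_ n) (x_ n)] converge in norm to [v].  Weak sequential
    closedness of [D] gives [D x], so everything reduces to showing that
    [w := x - T g x - v] vanishes.

    The point is that moving from [x_ n - x] by the fixed vector [w] hardly
    increases the norm.  Writing
      [(x_ n - x) + w = (x_ n - T (g_ n) (x_ n) - v)
                        + (T (g_ n) (x_ n) - T (g_ n) x) + (T (g_ n) x - T g x)],
    the outer terms tend to 0 in norm and nonexpansiveness bounds the middle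
    one by [`|x_ n - x|], so that [`|(x_ n - x) + w| <= `|x_ n - x| + e_ n] with
    [e_ n] tending to 0.  In a Hilbert space, squaring this inequality and
    expanding the left-hand side cancels [`|x_ n - x| ^+ 2] and leaves
      [`|w| ^+ 2 <= 2 * e_ n * `|x_ n - x| + e_ n ^+ 2
                    - 2 * inner w (x_ n - x)]
    (lemma [sqr_norm_perturbation_le]).  The last term tends to 0 by weak
    convergence ([weak_cvg_inner]); the first one does too because weakly
    convergent sequences are bounded ([weak_cvg_bounded], a consequence of the
    Banach-Steinhaus theorem).  Hence [w = 0]. *)

Section inner_product.
Context {R : realType} {X : hilbertType R}.
Implicit Types x y z w : X.

Lemma sqr_normD x y :
  `|x + y| ^+ 2 = `|x| ^+ 2 + 2 * inner x y + `|y| ^+ 2.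
Proof.
by rewrite !inner_normE hnormD /= expr0 mul1r; ring.
Qed.

(** Expanding the square turns the triangle inequality, already available for
    the norm, into the Cauchy-Schwarz inequality; applying it to [- x] as well
    handles the absolute value. *)
Lemma normr_inner_le x y : `|inner x y| <= `|x| * `|y|.
Proof.
have le_inner a : inner a y <= `|a| * `|y|.
  have : `|a + y| ^+ 2 <= (`|a| + `|y|) ^+ 2.
    by rewrite ler_sqr ?nnegrE ?addr_ge0 ?ler_normD.
  by rewrite sqr_normD; nra.
rewrite ler_norml le_inner andbT lerNl.
by rewrite -linearNl -[`|x|]normrN le_inner.
Qed.

Lemma inner_linear y : linear (inner y : X -> R^o).
Proof. by move=> a u v; rewrite linearDr linearZr_LR. Qed.

(** The functional [inner y] comes with a linear structure for the scaling
    [idfun \; *%R]; elements of the dual are linear for the scaling of [R^o]. *)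
Definition innerl y : {linear X -> R^o} :=
  HB.pack (inner y : X -> R^o)
    (GRing.isLinear.Build R X R^o _ (inner y : X -> R^o) (inner_linear y)).

Lemma bounded_fun_norm_inner y : bounded_fun_norm (inner y : X -> R^o).
Proof.
move=> r; exists (`|y| * r) => x xr.
by rewrite (le_trans (normr_inner_le y x))// ler_wpM2l.
Qed.

Lemma inner_continuous y : continuous (inner y : X -> R^o).
Proof.
apply: (@linear_continuous _ _ _ (innerl y)); apply/bounded_landau.
exact: bounded_fun_norm_inner.
Qed.

(** Squaring and expanding cancels [`|z| ^+ 2].  For bounded [z] the bound is
    small as soon as [e] and [inner w z] are, so it forces a fixed [w] to
    vanish when [z] runs over a sequence converging weakly to 0. *)
Lemma sqr_norm_perturbation_le z w (e : R) :
  `|z + w| <= `|z| + e ->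
  `|w| ^+ 2 <= 2 * e * `|z| + e ^+ 2 - 2 * inner w z.
Proof.
move=> le_zw.
have : `|w + z| ^+ 2 <= (`|z| + e) ^+ 2.
  by rewrite addrC ler_sqr ?nnegrE ?(le_trans _ le_zw).
by rewrite sqr_normD; nra.
Qed.

End inner_product.

Section weak_convergence.
Context {R : realType} {X : hilbertType R}.
Implicit Types x y : X.

Lemma weak_cvg_inner (x_ : nat -> X) x y : x_ @ \oo --> (x : weak X) ->
  inner y (x_ n) @[n --> \oo] --> inner y x.
Proof.
by move=> /weak_cvgP /(_ (innerl y) (@inner_continuous _ _ y)).
Qed.

(** By Banach-Steinhaus applied to the functionals [inner (x_ n)], which are
    pointwise bounded because the numerical sequences [inner (x_ n) y]
    converge; the uniform bound on the unit ball is a bound on [`|x_ n|], as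
    one sees by evaluating at the normalization of [x_ n]. *)
Lemma weak_cvg_bounded (x_ : nat -> X) x : x_ @ \oo --> (x : weak X) ->
  exists M, forall n, `|x_ n| <= M.
Proof.
move=> cx.
pose F : set (X -> R^o) := range (fun n => inner (x_ n) : X -> R^o).
have Flin f : F f -> bounded_fun_norm f /\ linear f.
  move=> [n _ <-]; split; first exact: bounded_fun_norm_inner.
  exact: inner_linear.
have Fpt : pointwise_bounded F.
  move=> y.
  have /cvg_seq_bounded[M [_ Mb]] : cvgn (fun n => inner y (x_ n)).
    by apply/cvg_ex; exists (inner y x); exact: weak_cvg_inner.
  exists (M + 1) => _ [n _ <-].
  rewrite hermC /= expr0 mul1r; apply: Mb (M + 1) _ n I.
  by rewrite ltrDl.
have [M leM] := Banach_Steinhauss Flin Fpt 1.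
exists M => n.
have := leM _ (ex_intro2 _ _ n I erefl) (`|x_ n|^-1 *: x_ n).
(* For [x_ n = 0] the test vector is 0 and the bound reads [`|0| <= M]. *)
have [->|xn0] := eqVneq (x_ n) 0.
  by rewrite normr0 invr0 scaler0 linear0r !normr0; apply.
rewrite normrZ normfV normr_id mulVf ?normr_eq0// => /(_ (lexx _)).
rewrite linearZr_LR /= -inner_normE expr2 mulKf ?normr_eq0//.
by rewrite normr_id.
Qed.

End weak_convergence.

Lemma within_continuous_cvg (R : realType) (V : normedModType R) (A : set R)
    (f : R -> V) (g_ : nat -> R) (g : R) :
  {within A, continuous f} -> (forall n, A (g_ n)) -> A g ->
  g_ @ \oo --> g -> f (g_ n) @[n --> \oo] --> f g.
Proof.
move=> /subspace_continuousP cf Ag_ Ag cg.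
apply: (cvg_comp g_ f _ (cf g Ag)) => B; rewrite /within /= => gB.
have gB_ : \forall n \near \oo, A (g_ n) -> B (g_ n) := cg _ gB.
by apply: filterS gB_ => n /(_ (Ag_ n)).
Qed.

Theorem theorem3p9 (R : realType) (X : hilbertType R)
    (D : set X) (Gamma : set R) (T : R -> X -> X)
    (D_neq0 : D !=set0) (D_wclosed : weakly_sequentially_closed D)
    (Gamma_neq0 : Gamma !=set0) (Gamma_closed : closed Gamma)
    (T_nonexpansive : forall gamma, Gamma gamma -> nonexpansive D (T gamma))
    (T_continuous : forall x, D x ->
      {within Gamma, continuous (fun gamma => T gamma x)}) :
  parametrically_demiclosed D Gamma (fun x gamma => x - T gamma x).
Proof.
apply/parametrically_demiclosedP => x_ g_ x g v Dx_ Gg_ Gg cx cg cv.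
have Dx : D x by exact: D_wclosed cx.
split=> //.
have cT := within_continuous_cvg (T_continuous x Dx) Gg_ Gg cg.
pose w := x - T g x - v.
pose e_ n := `|x_ n - T (g_ n) (x_ n) - v| + `|T (g_ n) x - T g x|.
have ce : e_ n @[n --> \oo] --> (0 : R).
  rewrite -[0 : R]addr0; apply: cvgD.
    by apply/norm_cvg0P; rewrite -(subrr v); apply: cvgB => //; exact: cvg_cst.
  apply/norm_cvg0P; rewrite -(subrr (T g x)); apply: cvgB => //; exact: cvg_cst.
have le_w n : `|x_ n - x + w| <= `|x_ n - x| + e_ n.
  have -> : x_ n - x + w = (T (g_ n) (x_ n) - T (g_ n) x) +
      ((x_ n - T (g_ n) (x_ n) - v) + (T (g_ n) x - T g x)).
    by rewrite [RHS]addrCA subrKA [RHS]addrAC subrKA /w !addrA subrK.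
  rewrite (le_trans (ler_normD _ _))// lerD ?ler_normD//.
  exact: T_nonexpansive.
have [M leM] := weak_cvg_bounded cx.
pose b_ n := 2 * e_ n * (M + `|x|) + e_ n ^+ 2
  - 2 * (inner w (x_ n) - inner w x).
have le_b n : `|w| ^+ 2 <= b_ n.
  apply: le_trans (sqr_norm_perturbation_le (le_w n)) _.
  rewrite linearBr /b_ lerD2r lerD2r ler_wpM2l ?mulr_ge0 ?addr_ge0//.
  by rewrite (le_trans (ler_normB _ _))// lerD2r.
have cb : b_ n @[n --> \oo] --> (0 : R).
  have -> : (0 : R) = 2 * 0 * (M + `|x|) + 0 ^+ 2
      - 2 * (inner w x - inner w x) by ring.
  apply: cvgB; first apply: cvgD.
  - by apply: cvgMl; apply: cvgMr.
  - by rewrite expr2; under eq_fun do rewrite expr2; apply: cvgM.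
  - apply: cvgMr; apply: cvgB; last exact: cvg_cst.
    exact: weak_cvg_inner.
have : `|w| ^+ 2 <= 0.
  rewrite -(cvg_lim _ cb)//; apply: limr_ge; first by apply/cvg_ex; exists 0.
  exact: nearW.
by rewrite exprn_even_le0//= normr_eq0 subr_eq0 => /eqP.
Qed.
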